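(* For every nonnegative integer $n$, the sequence of polynomials $$D_{0,n}(q),\ D_{1,n-1}(q),\ \ldots,\ D_{n,0}(q)$$ is $q$-unimodal.
   Context: Consider lattice paths in $\mathbb{Z}^2$ starting at $(0,0)$ and using steps $N=[0,1]$, $E=[1,0]$ and $D=[1,1]$. For integers $i,j\ge 0$ let $D_{i,j}(q)=\sum_p q^{d(p)}$, where the sum is over all such paths $p$ ending at $(i,j)$ and $d(p)$ is the number of $D$ steps of $p$. For polynomials $a(q),b(q)$ write $a(q)\le_q b(q)$ if for every $i$ the coefficient of $q^i$ in $a(q)$ is at most the coefficient of $q^i$ in $b(q)$. A sequence of polynomials $(a_k(q))_{k\ge0}$ is $q$-unimodal if there is an index $m$ with $a_0(q)\le_q a_1(q)\le_q\cdots\le_q a_m(q)$ and $a_m(q)\ge_q a_{m+1}(q)\ge_q\cdots$. *)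

(* Defs.v *)
From HB Require Import structures.
From mathcomp Require Import all_boot all_order all_algebra.

Set Implicit Arguments.
Unset Strict Implicit.
Unset Printing Implicit Defensive.

Import Order.TTheory GRing.Theory Num.Theory.
Local Open Scope ring_scope.

Inductive step := North | East | Diag.

Definition step_code (s : step) : option bool :=
  match s with North => Some true | East => Some false | Diag => None end.
Definition step_decode (c : option bool) : step :=
  match c with Some true => North | Some false => East | None => Diag end.
Lemma step_codeK : cancel step_code step_decode. Proof. by case. Qed.

HB.instance Definition _ := Finite.copy step (can_type step_codeK).

Definition step_vec (s : step) : int * int :=
  match s with North => (0, 1) | East => (1, 0) | Diag => (1, 1) end.

(* A path is the sequence of its steps; it starts at the origin. *)
Definition path_end (p : seq step) : int * int := \sum_(s <- p) step_vec s.

Definition diag_count (p : seq step) : nat := count_mem Diag p.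

(* No path ending at (i, j) is longer than i + j. *)
Lemma path_end_size (p : seq step) (i j : nat) :
  path_end p = (i%:Z, j%:Z) -> (size p <= i + j)%N.
Proof.
suff H : (size p)%:Z <= (path_end p).1 + (path_end p).2.
  by move=> E; rewrite E /= -PoszD lez_nat in H.
rewrite /path_end; elim: p => [|s p IH] /=; first by rewrite big_nil.
rewrite big_cons intS; set v := \sum_(_ <- _) _ in IH *.
rewrite [(_ + v).1]/(_ + v.1) [(_ + v).2]/(_ + v.2) addrACA.
by apply: lerD IH; case: s.
Qed.

(* The finitely many paths ending at (i, j) are grouped by their length k,
   which is at most i + j by path_end_size. *)
Definition delannoy (i j : nat) : {poly int} :=
  \sum_(k < (i + j).+1)
    \sum_(p : k.-tuple step | path_end p == (i%:Z, j%:Z)) 'X^(diag_count p).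

Definition le_q (a b : {poly int}) : Prop := forall i : nat, a`_i <= b`_i.

Definition q_unimodal (s : seq {poly int}) : Prop :=
  exists m : nat,
    [/\ (m < size s)%N,
        forall k : nat, (k < m)%N -> le_q s`_k s`_k.+1
      & forall k : nat, (m <= k)%N -> (k.+1 < size s)%N -> le_q s`_k.+1 s`_k].

(* Main.v *)
Require Import Defs.
From mathcomp Require Import all_boot all_order all_algebra.
From mathcomp Require Import zify.

(** Fix the number k of steps and let the endpoint (x, y) range over all of Z^2.
    Removing the first step gives a recurrence in k, with no boundary cases.
    By induction on k, for x < y the generating function at (x, y) is at most
    the one at (x + 1, y - 1): after cancelling the common term (x, y - 1), one
    compares (x - 1, y) with (x + 1, y - 2) and (x - 1, y - 1) with (x, y - 2).
    The first comparison goes through (x, y - 1) if x < y - 1, and is an equality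
    by the symmetry in x and y if x = y - 1. *)

Import Order.TTheory GRing.Theory Num.Theory.
Local Open Scope ring_scope.

Definition path_gf (k : nat) (x y : int) : {poly int} :=
  \sum_(p : k.-tuple step | path_end p == (x, y)) 'X^(diag_count p).

Lemma big_step (V : nmodType) (F : step -> V) :
  \sum_s F s = F North + F East + F Diag.
Proof.
rewrite (bigD1 North) // (bigD1 East) // (bigD1 Diag) //= big1 ?addr0 ?addrA //.
by case.
Qed.

Lemma path_end_cons s p x y :
  (path_end (s :: p) == (x, y)) =
  (path_end p == (x - (step_vec s).1, y - (step_vec s).2)).
Proof.
rewrite /path_end big_cons; case: (\sum_(_ <- _) _) => a b.
by case: s; rewrite !xpair_eqE /=; lia.
Qed.

Lemma path_gf0 x y : path_gf 0 x y = ((x == 0) && (y == 0))%:R.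
Proof.
rewrite /path_gf big_mkcond (big_pred1 [tuple]) => [|p]; last first.
  by rewrite /= [p]tuple0; apply/esym/eqP/val_inj.
rewrite /path_end big_nil xpair_eqE ![0 == _]eq_sym.
by case: ifP => _; rewrite ?expr0.
Qed.

Lemma path_gfS k x y :
  path_gf k.+1 x y =
  path_gf k x (y - 1) + path_gf k (x - 1) y + 'X * path_gf k (x - 1) (y - 1).
Proof.
rewrite /path_gf (reindex (fun u : step * k.-tuple step => [tuple of u.1 :: u.2])) /=;
  last first.
  exists (fun p => (thead p, [tuple of behead p])) => [[s p]|p] _ /=.
    by congr pair; apply: val_inj.
  by rewrite -tuple_eta.
(* The trivial conjunct [true] gives the condition the shape that [pair_big_dep] expects. *)
rewrite (eq_bigl (fun u : step * k.-tuple step => true && (path_end (u.1 :: u.2) == (x, y)))) //.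
rewrite -(pair_big_dep xpredT (fun s (p : k.-tuple step) => path_end (s :: p) == (x, y))
  (fun s p => 'X^(diag_count (s :: p)))) /= big_step.
rewrite mulr_sumr; congr (_ + _ + _); apply: eq_big => p;
  rewrite ?path_end_cons /= ?subr0 // => _.
by rewrite /diag_count /= exprS.
Qed.

Lemma path_gfC k x y : path_gf k x y = path_gf k y x.
Proof.
elim: k x y => [|k IHk] x y; first by rewrite !path_gf0 andbC.
by rewrite !path_gfS IHk (IHk (x - 1) y) (IHk (x - 1)) (addrC (path_gf _ _ _)).
Qed.

Lemma le_q_trans b a c : le_q a b -> le_q b c -> le_q a c.
Proof. by move=> ab bc i; apply: le_trans (ab i) (bc i). Qed.

Lemma le_qD a b c d : le_q a b -> le_q c d -> le_q (a + c) (b + d).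
Proof. by move=> ab cd i; rewrite !coefD lerD. Qed.

Lemma le_qMX a b : le_q a b -> le_q ('X * a) ('X * b).
Proof. by move=> ab i; rewrite !coefXM; case: ifP. Qed.

Lemma path_gf_incr k x y : x < y -> le_q (path_gf k x y) (path_gf k (x + 1) (y - 1)).
Proof.
elim: k x y => [|k IHk] x y xy.
  (* The empty path ends at the origin, which [x < y] excludes. *)
  rewrite !path_gf0 (_ : (x == 0) && (y == 0) = false); last by lia.
  by move=> i; rewrite coef0; case: (_ && _); rewrite ?coef1 ?coef0 //; case: eqP.
(* The common term at [(x, y - 1)] comes from a North step on the left and an East step on the
   right; the swap aligns the two. *)
rewrite !path_gfS addrK [X in le_q _ (X + _)]addrC.
apply: le_qD; last first.
  by have := IHk (x - 1) (y - 1); rewrite subrK => H; apply/le_qMX/H; lia.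
apply: le_qD => //.
have step1 : le_q (path_gf k (x - 1) y) (path_gf k x (y - 1)).
  by have := IHk (x - 1) y; rewrite subrK; apply; lia.
have [xy1|yx1] := ltP x (y - 1); first exact: le_q_trans step1 (IHk _ _ xy1).
have -> : y = x + 1 by lia.
by rewrite addrK path_gfC.
Qed.

Lemma delannoyE i j : delannoy i j = \sum_(k < (i + j).+1) path_gf k i j.
Proof. by []. Qed.

Lemma delannoyC i j : delannoy i j = delannoy j i.
Proof. by rewrite !delannoyE addnC; apply: eq_bigr => k _; exact: path_gfC. Qed.

(** Both endpoints have the same coordinate sum, so the lengths [k] run over the same range and
    [path_gf_incr] applies for each [k]. *)
Lemma delannoy_incr i j : (i <= j)%N -> le_q (delannoy i j.+1) (delannoy i.+1 j).
Proof.
move=> ij d; rewrite !delannoyE addSnnS !coef_sum; apply: ler_sum => k _.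
have := @path_gf_incr k i j.+1.
have -> : j.+1%:Z - 1 = j by lia.
have -> : i%:Z + 1 = i.+1 by lia.
by apply; lia.
Qed.

Theorem theorem4p1 (n : nat) :
  q_unimodal [seq delannoy k (n - k) | k <- iota 0 n.+1].
Proof.
have nthE k : (k <= n)%N ->
    [seq delannoy k (n - k) | k <- iota 0 n.+1]`_k = delannoy k (n - k).
  by move=> kn; rewrite (nth_map 0%N) ?size_iota // nth_iota.
(* For [k < n./2] one has [k <= n - k.+1], as [delannoy_incr] requires. *)
exists n./2; rewrite size_map size_iota; split=> [|k kn|k nk kn]; first by lia.
  rewrite !nthE; try lia.
  rewrite (_ : n - k = (n - k.+1).+1)%N; last by lia.
  by apply: delannoy_incr; lia.
rewrite !nthE; try lia.
(* Symmetry reflects the descending half onto the ascending one: here [n - k.+1 <= k]. *)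
rewrite (delannoyC k) (delannoyC k.+1) (_ : n - k = (n - k.+1).+1)%N; last by lia.
by apply: delannoy_incr; lia.
Qed.
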